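(* Let $\pi$ be a permutation that has opposing adjacencies, i.e. $\pi$ contains at least one up-adjacency and at least one down-adjacency. Then $\mu[1,\pi]=0$.
   Context: Permutations of length $n$ are written in one-line notation $\pi=\pi_1\pi_2\cdots\pi_n$ (a bijection of $\{1,\dots,n\}$). A permutation $\sigma$ is contained in $\pi$, written $\sigma\le\pi$, if some subsequence of $\pi$ (not necessarily of consecutive entries) is order-isomorphic to $\sigma$. This makes the set of all permutations of all lengths a poset; $1$ denotes the permutation of length one. The Möbius function of this poset is defined recursively by $\mu[\sigma,\pi]=0$ if $\sigma\not\le\pi$, $\mu[\sigma,\sigma]=1$, and $\mu[\sigma,\pi]=-\sum_{\sigma\le\tau<\pi}\mu[\sigma,\tau]$ if $\sigma<\pi$. The value $\mu[1,\pi]$ is called the principal Möbius function of $\pi$. An interval of a permutation $\pi$ is a non-empty set of contiguous indices $i,i+1,\dots,j$ such that the set of values $\{\pi_i,\dots,\pi_j\}$ is also a set of contiguous integers. An adjacency is an interval of length two, i.e. an index pair $i,i+1$ with $|\pi_{i+1}-\pi_i|=1$; it is an up-adjacency if $\pi_{i+1}=\pi_i+1$ and a down-adjacency if $\pi_{i+1}=\pi_i-1$. *)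

(* Defs.v *)
From mathcomp Require Import all_boot all_order all_fingroup all_algebra.

Set Implicit Arguments.
Unset Strict Implicit.
Unset Printing Implicit Defensive.

(** Permutations of all lengths. Positions and values are numbered from 0
    instead of 1. The empty permutation is included; it lies in no interval
    [[s, p]] with [s] nonempty. *)
Definition permutation : Type := {n : nat & 'S_n}.

Definition mkperm n (p : 'S_n) : permutation := Tagged (fun n => 'S_n) p.

Definition perm_length (p : permutation) : nat := tag p.

Definition singleton_perm : permutation := mkperm (1%g : 'S_1).

(** [f] lists the positions of a subsequence of [p] order-isomorphic to [s]. *)
Definition occurrence m n (s : 'S_m) (p : 'S_n) (f : {ffun 'I_m -> 'I_n}) :
    bool :=
  [forall i : 'I_m, forall j : 'I_m, (i < j) ==> (f i < f j)] &&
  [forall i : 'I_m, forall j : 'I_m, (s i < s j) == (p (f i) < p (f j))].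

Definition contained (s p : permutation) : bool :=
  [exists f, occurrence (tagged s) (tagged p) f].

Definition strictly_contained (s p : permutation) : bool :=
  (s != p) && contained s p.

(** The counter [k] only makes the recursion structural; [mobiusE] is the
    defining recurrence. The sum ranges over all [t] with [s <= t < p], since
    such a [t] is at most as long as [p] ([contained_length]). *)
Fixpoint mobius_rec (k : nat) (s p : permutation) : int :=
  if s == p then 1%R
  else if k is k'.+1 then
    if contained s p then
      (- \sum_(l < (perm_length p).+1)
          \sum_(t : 'S_l | contained s (mkperm t) &&
                           strictly_contained (mkperm t) p)
             mobius_rec k' s (mkperm t))%R
    else 0%R
  else 0%R.

Definition mobius (s p : permutation) : int := mobius_rec (perm_length p) s p.

Lemma contained_length s p : contained s p -> perm_length s <= perm_length p.
Proof.
case: s p => [m s] [n p] /existsP[/= f /andP[/forallP fP _]].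
have lt_f (i j : 'I_m) : i < j -> f i < f j by have /forallP/(_ j)/implyP := fP i.
have injf : injective f.
  move=> i j eqf; apply/val_inj/eqP; case: ltngtP => // /lt_f.
    by rewrite eqf ltnn.
  by rewrite eqf ltnn.
by have := leq_card f injf; rewrite !card_ord.
Qed.

Lemma increasing_ord_id n (f : {ffun 'I_n -> 'I_n}) :
  (forall i j : 'I_n, i < j -> f i < f j) -> forall i, f i = i.
Proof.
move=> fP.
have ge_id k : forall i : 'I_n, i = k :> nat -> k <= f i.
  elim: k => // k IH i ik.
  have kn : k < n by rewrite (leq_trans _ (ltn_ord i)) // ik.
  apply: leq_ltn_trans (IH (Ordinal kn) erefl) (fP _ _ _).
  by rewrite ik.
have le_id k : forall i : 'I_n, n = i + k.+1 -> f i <= i.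
  elim: k => [|k IH] i ik.
    by rewrite -ltnS (leq_trans (ltn_ord (f i))) // [X in X <= _]ik addn1.
  have kn : i.+1 < n.
    by rewrite [X in _ < X]ik addnS ltnS -[X in X < _]addn0 ltn_add2l.
  have lt := fP i (Ordinal kn) (leqnn _).
  by rewrite -ltnS (leq_trans lt) // IH //= addSnnS.
move=> i; apply/val_inj/eqP; rewrite eqn_leq (ge_id _ _ erefl) andbT.
by apply: (le_id (n - i.+1)); rewrite -addSnnS subnKC.
Qed.

Lemma order_iso_perm n (s p : 'S_n) :
  (forall i j, (s i < s j) = (p i < p j)) -> s = p.
Proof.
move=> sp; apply/permP=> i.
pose g : {ffun 'I_n -> 'I_n} := [ffun x => p ((s^-1)%g x)].
have gP (x y : 'I_n) : x < y -> g x < g y.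
  by move=> xy; rewrite !ffunE -sp !permKV.
by have := increasing_ord_id gP (s i); rewrite ffunE permK.
Qed.

Lemma strictly_contained_length s p :
  strictly_contained s p -> perm_length s < perm_length p.
Proof.
case/andP=> neq sp; rewrite ltn_neqAle contained_length // andbT.
apply: contraNneq neq; move: sp; case: s p => [m s] [n p] /existsP[/= f].
rewrite /perm_length /= => fP mn; case: n / mn p f fP => p f.
case/andP=> /forallP f1 /forallP f2.
have fid : forall i, f i = i.
  by apply: increasing_ord_id => i j; have /forallP/(_ j)/implyP := f1 i.
suff -> : s = p by [].
apply: order_iso_perm => i j; have /forallP/(_ j)/eqP := f2 i.
by rewrite !fid.
Qed.

Lemma mobius_rec_stable k k' s p :
  perm_length p <= k -> perm_length p <= k' ->
  mobius_rec k s p = mobius_rec k' s p.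
Proof.
have short q : perm_length q <= 0 -> s != q -> contained s q = false.
  move=> q0 sq; apply: contraTF q0 => cq; rewrite -ltnNge.
  by rewrite (leq_ltn_trans (leq0n _) (@strictly_contained_length s q _)) //
             /strictly_contained sq.
elim: k k' p => [|k IH] [|k'] p pk pk' //=; case: eqP => // /eqP sp.
- by rewrite short.
- by rewrite short.
case: ifP => // _; congr (- _)%R; apply: eq_bigr => l _.
apply: eq_bigr => t /andP[_ /strictly_contained_length lt].
by apply: IH; rewrite -ltnS (leq_trans lt).
Qed.

Lemma mobiusE s p :
  mobius s p =
  if s == p then 1%R
  else if contained s p then
    (- \sum_(l < (perm_length p).+1)
        \sum_(t : 'S_l | contained s (mkperm t) &&
                         strictly_contained (mkperm t) p)
           mobius s (mkperm t))%R
  else 0%R.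
Proof.
rewrite /mobius (@mobius_rec_stable _ (perm_length p).+1) //=.
case: eqP => // _; case: ifP => // _; congr (- _)%R.
apply: eq_bigr => l _; apply: eq_bigr => t /andP[_ /strictly_contained_length].
by move=> lt; apply: mobius_rec_stable => //; exact: ltnW.
Qed.

Definition up_adjacency n (p : 'S_n) (i j : 'I_n) : bool :=
  (j == i.+1 :> nat) && (p j == (p i).+1 :> nat).

Definition down_adjacency n (p : 'S_n) (i j : 'I_n) : bool :=
  (j == i.+1 :> nat) && (p i == (p j).+1 :> nat).

Definition has_opposing_adjacencies (p : permutation) : Prop :=
  (exists i j, up_adjacency (tagged p) i j) /\
  (exists i j, down_adjacency (tagged p) i j).

(* Main.v *)
Require Import Defs.
From mathcomp Require Import all_boot all_order all_fingroup all_algebra.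
From mathcomp Require Import zify.

(** Let [i, j] be an up-adjacency and [k, l] a down-adjacency of [p], and let
    [p_A] denote the pattern of [p] on a set [A] of positions. An occurrence of
    [t] in [p] using both points of an adjacency exhibits an adjacency of the
    same kind in [t]; otherwise it can be moved off [j] (or [l]). So every
    [t < p] without opposing adjacencies lies below [p_(~j)] or [p_(~l)], and
    below both iff it lies below [p_(~{j, l})]. As the other [t < p] have
    [mu[1, t] = 0] by induction, [- mu[1, p]] is the signed combination of the
    sums of [mu[1, -]] over three principal down-sets, each of which is 0. *)

Set Implicit Arguments.
Unset Strict Implicit.
Unset Printing Implicit Defensive.

Import GRing.Theory.

(** * Occurrences, and patterns on sets of positions *)

Lemma occurrenceP m n (s : 'S_m) (p : 'S_n) (f : {ffun 'I_m -> 'I_n}) :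
  reflect ((forall i j : 'I_m, (f i < f j) = (i < j)) /\
           (forall i j, (s i < s j) = (p (f i) < p (f j))))
          (occurrence s p f).
Proof.
apply: (iffP andP) => [[/forallP f1 /forallP f2]|[f1 f2]]; last first.
  by split; apply/forallP => i; apply/forallP => j; rewrite ?f1 ?implybb ?f2.
have lt_f (i j : 'I_m) : i < j -> f i < f j by have /forallP/(_ j)/implyP := f1 i.
split=> i j; last by have /forallP/(_ j)/eqP := f2 i.
case: (ltngtP i j) => [/lt_f-> //|/lt_f|/val_inj ->]; last by rewrite ltnn.
by move=> ji; apply/negbTE; rewrite -leqNgt ltnW.
Qed.

Lemma contained_refl : reflexive contained.
Proof.
move=> [n p]; apply/existsP; exists [ffun x => x] => /=; apply/occurrenceP.
by split=> i j; rewrite !ffunE.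
Qed.

Lemma contained_singleton p : contained singleton_perm p = (0 < perm_length p).
Proof.
apply/idP/idP => [/contained_length //|]; case: p => [[//|n] p] _.
apply/existsP; exists [ffun _ => ord0] => /=; apply/occurrenceP.
by split=> i j; rewrite !ffunE ?(ord1 i) ?(ord1 j) !ltnn.
Qed.

(** An occurrence of [t] in [p] whose positions all lie in the image of [g] factors through [g], and
    the factor is again an occurrence because [g] preserves and reflects both orders. *)
Lemma contained_via_occurrence m n k (t : 'S_m) (q : 'S_k) (p : 'S_n) g :
    occurrence q p g ->
  contained (mkperm t) (mkperm q) <->
  exists2 f, occurrence t p f & {subset codom f <= codom g}.
Proof.
move=> /occurrenceP[g1 g2]; split=> [/existsP[/= h /occurrenceP[h1 h2]]|].
  exists [ffun x => g (h x)]; last first.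
    by move=> _ /codomP[x ->]; rewrite ffunE codom_f.
  by apply/occurrenceP; split=> x y; rewrite !ffunE ?g1 ?h1 // h2 g2.
case=> f /occurrenceP[f1 f2] fg.
have fgx x : f x \in codom g by apply/fg/codom_f.
apply/existsP; exists [ffun x => iinv (fgx x)] => /=; apply/occurrenceP.
split=> x y; rewrite !ffunE; first by rewrite -g1 !f_iinv f1.
by rewrite g2 !f_iinv f2.
Qed.

(** The pattern of [p] on [A] lists [A] increasingly and replaces each value by its rank [c] among
    the values of [p] on [A]. Only the permutations it contains matter later, so the statement
    records just those. *)
Lemma exists_pattern n (p : 'S_n) (A : {set 'I_n}) :
  exists q : 'S_#|A|, forall m (t : 'S_m), contained (mkperm t) (mkperm q) <->
    exists2 f, occurrence t p f & {subset codom f <= A}.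
Proof.
pose c x := #|[set y in A | p y < p x]|.
have c_mono x y : x \in A -> p x < p y -> c x < c y.
  move=> Ax xy; apply/proper_card/properP; split; last first.
    by exists x; rewrite !inE Ax ?ltnn.
  apply/subsetP => z; rewrite !inE => /andP[-> /=] zx.
  exact: ltn_trans zx xy.
have c_lt x y : x \in A -> y \in A -> (c x < c y) = (p x < p y).
  move=> Ax Ay; apply/idP/idP; last exact: c_mono.
  case: (ltngtP (p x) (p y)) => // [/(c_mono _ _ Ay) yx|/val_inj/perm_inj ->].
    by rewrite ltnNge ltnW.
  by rewrite ltnn.
have c_card x : x \in A -> c x < #|A|.
  move=> Ax; apply/proper_card/properP; split.
    by apply/subsetP => z; rewrite !inE => /andP[].
  by exists x; rewrite // !inE Ax ltnn.
pose g : {ffun 'I_#|A| -> 'I_n} := [ffun i => Order.enum_val (A := A) i].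
have gA i : g i \in A by rewrite ffunE Order.enum_valP.
have g_mono (i j : 'I_#|A|) : (g i < g j) = (i < j).
  by rewrite !ffunE ltnNge [RHS]ltnNge; congr (~~ _); apply: (@Order.le_enum_val _ 'I_n (fun x y => leq_total x y)).
pose q i := Ordinal (c_card _ (gA i)).
have q_inj : injective q.
  move=> i j /(congr1 val) /= cij.
  have gij : g i = g j.
    apply: (@perm_inj _ p); apply/val_inj.
    by case: (ltngtP (p (g i)) (p (g j))) => //; rewrite -c_lt // cij ltnn.
  by apply/val_inj; case: (ltngtP i j) => //; rewrite -g_mono gij ltnn.
exists (perm q_inj) => m t.
have qg : occurrence (perm q_inj) p g.
  by apply/occurrenceP; split=> i j; rewrite ?g_mono // !permE /= c_lt.
suff gE : codom g =i A.
  apply: (iff_trans (contained_via_occurrence t qg)).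
  by split=> -[f ft fA]; exists f => // x /fA; rewrite gE.
move=> x; apply/codomP/idP => [[i ->] //|Ax].
by exists (Order.enum_rank_in Ax x); rewrite ffunE Order.enum_rankK_in.
Qed.

(** * Occurrences meeting an adjacency *)

(** An entry of [t] strictly between [x] and [y] in position or in value would be sent by [f]
    strictly between [f x] and [f y], where there is no room. *)
Lemma up_adjacency_occurrence m n (t : 'S_m) (p : 'S_n) f x y :
  occurrence t p f -> up_adjacency p (f x) (f y) -> up_adjacency t x y.
Proof.
move=> /occurrenceP[f1 f2] /andP[/eqP pos /eqP val]; apply/andP; split.
- rewrite eqn_leq -f1 pos leqnn andbT leqNgt; apply/negP => lt.
  have lx : x.+1 < m by apply: ltn_trans lt (ltn_ord y).
  have := f1 x (Ordinal lx); have := f1 (Ordinal lx) y; rewrite lt /=; lia.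
- rewrite eqn_leq f2 val leqnn andbT leqNgt; apply/negP => lt.
  have lx : (t x).+1 < m by apply: ltn_trans lt (ltn_ord (t y)).
  have := f2 x ((t^-1)%g (Ordinal lx)); have := f2 ((t^-1)%g (Ordinal lx)) y.
  rewrite permKV lt /=; lia.
Qed.

Lemma down_adjacency_occurrence m n (t : 'S_m) (p : 'S_n) f x y :
  occurrence t p f -> down_adjacency p (f x) (f y) -> down_adjacency t x y.
Proof.
move=> /occurrenceP[f1 f2] /andP[/eqP pos /eqP val]; apply/andP; split.
- rewrite eqn_leq -f1 pos leqnn andbT leqNgt; apply/negP => lt.
  have lx : x.+1 < m by apply: ltn_trans lt (ltn_ord y).
  have := f1 x (Ordinal lx); have := f1 (Ordinal lx) y; rewrite lt /=; lia.
- rewrite eqn_leq f2 val leqnn andbT leqNgt; apply/negP => lt.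
  have lx : (t y).+1 < m by apply: ltn_trans lt (ltn_ord (t x)).
  have := f2 y ((t^-1)%g (Ordinal lx)); have := f2 ((t^-1)%g (Ordinal lx)) x.
  rewrite permKV lt /=; lia.
Qed.

(** No position lies strictly between [i] and [j] and no value strictly between [p i] and [p j], so
    using [i] instead of [j] changes no comparison with the other points of the occurrence. *)
Lemma occurrence_shift m n (t : 'S_m) (p : 'S_n) f (i j : 'I_n) :
    up_adjacency p i j || down_adjacency p i j -> occurrence t p f ->
    i \notin codom f ->
  exists f', occurrence t p f' /\
    {subset codom f' <= [predD1 [predU1 i & codom f] & j]}.
Proof.
move=> adj /occurrenceP[f1 f2] nif.
have fi x : f x != i by apply: contraNneq nif => <-; apply: codom_f.
have pos : j = i.+1 :> nat by case/orP: adj => /andP[/eqP].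
have val : p j = (p i).+1 :> nat \/ p i = (p j).+1 :> nat.
  by case/orP: adj => /andP[_ /eqP]; [left|right].
exists [ffun x => if f x == j then i else f x]; split; last first.
  move=> _ /codomP[x ->]; rewrite !inE !ffunE.
  case: (eqVneq (f x) j) => [_|fj]; last by rewrite fj codom_f orbT.
  rewrite eqxx andbT; apply/eqP => ij; move: pos; rewrite ij; lia.
have pfi x : p (f x) != p i :> nat by rewrite (inj_eq val_inj) (inj_eq perm_inj).
have pfj x : f x != j -> p (f x) != p j :> nat.
  by rewrite (inj_eq val_inj) (inj_eq perm_inj).
have fi' x : f x != i :> nat by rewrite (inj_eq val_inj).
have fj' x : f x != j -> f x != j :> nat by rewrite (inj_eq val_inj).
apply/occurrenceP; split=> x y; rewrite !ffunE; [rewrite -f1|rewrite f2].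
  have := fi' x; have := fi' y.
  case: (eqVneq (f x) j) => [->|/fj']; case: (eqVneq (f y) j) => [->|/fj']; lia.
have := pfi x; have := pfi y.
by case: (eqVneq (f x) j) => [->|/pfj]; case: (eqVneq (f y) j) => [->|/pfj]; lia.
Qed.

(** The occurrence cannot use both [i] and [j]. If it uses [i], it already avoids [j]; otherwise it
    can be shifted. The bound on the new image, which gains at most [i], lets a second deleted point
    stay avoided. *)
Lemma up_adjacency_avoid m n (t : 'S_m) (p : 'S_n) f (i j : 'I_n) :
    up_adjacency p i j -> occurrence t p f -> (forall x y, ~~ up_adjacency t x y) ->
  exists f', occurrence t p f' /\
    {subset codom f' <= [predD1 [predU1 i & codom f] & j]}.
Proof.
move=> adj ft nt; case: (boolP (i \in codom f)) => [/codomP[x ix]|]; last first.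
  by apply: occurrence_shift ft; rewrite adj.
case: (boolP (j \in codom f)) => [/codomP[y jy]|jf].
  by case/negP: (nt x y); apply: up_adjacency_occurrence ft _; rewrite -ix -jy.
exists f; split=> // z zf; rewrite !inE zf orbT andbT.
by apply: contraNneq jf => <-.
Qed.

Lemma down_adjacency_avoid m n (t : 'S_m) (p : 'S_n) f (i j : 'I_n) :
    down_adjacency p i j -> occurrence t p f ->
    (forall x y, ~~ down_adjacency t x y) ->
  exists f', occurrence t p f' /\
    {subset codom f' <= [predD1 [predU1 i & codom f] & j]}.
Proof.
move=> adj ft nt; case: (boolP (i \in codom f)) => [/codomP[x ix]|]; last first.
  by apply: occurrence_shift ft; rewrite adj orbT.
case: (boolP (j \in codom f)) => [/codomP[y jy]|jf].
  by case/negP: (nt x y); apply: down_adjacency_occurrence ft _; rewrite -ix -jy.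
exists f; split=> // z zf; rewrite !inE zf orbT andbT.
by apply: contraNneq jf => <-.
Qed.

(** * Vanishing sums over principal down-sets *)

(** This is the recurrence for [q], which differs from the singleton, with the term of [q] moved
    into the sum. The free bound [N] gives sums for different [q] a common range of lengths. *)
Lemma mobius_lower_sum N (q : permutation) :
    1 < perm_length q -> perm_length q <= N ->
  (\sum_(l < N.+1) \sum_(t : 'S_l | contained singleton_perm (mkperm t) &&
      contained (mkperm t) q) mobius singleton_perm (mkperm t) = 0)%R.
Proof.
case: q => n q; rewrite /perm_length /= => n1 nN.
have nN1 : n < N.+1 by [].
have q1 : singleton_perm != mkperm q.
  by apply: contraTneq n1 => /(congr1 perm_length); rewrite /perm_length /= => <-.
have sq : contained singleton_perm (mkperm q) by rewrite contained_singleton ltnW.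
have := mobiusE singleton_perm (mkperm q).
rewrite (negPf q1) sq => muq.
pose F l := (\sum_(t : 'S_l | contained singleton_perm (mkperm t) &&
   strictly_contained (mkperm t) (mkperm q)) mobius singleton_perm (mkperm t))%R.
(* Lengths above [n] contribute empty sums. *)
have wide : (\sum_(l < n.+1) F l = \sum_(l < N.+1) F l)%R.
  rewrite (big_ord_widen N.+1 F) // big_mkcond; apply: eq_bigr => l _.
  case: ifP => // ln; rewrite /F big_pred0 // => t.
  apply/negbTE; rewrite negb_and; apply/orP; right.
  by apply: contraFN ln => /strictly_contained_length /ltnW.
rewrite (bigD1 (Ordinal nN1)) //= (bigD1 q) /=; last first.
  by rewrite sq; apply: contained_refl.
rewrite muq wide (bigD1 (Ordinal nN1) (F := F)) //= [X in (_ + _ + X)%R](_ : _ =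
  \sum_(i < N.+1 | i != Ordinal nN1) F i)%R; last first.
  apply: eq_bigr => l ln; apply: eq_bigl => t; congr (_ && _).
  rewrite /strictly_contained; suff -> : mkperm t != mkperm q by [].
  by apply: contraNneq ln => /(congr1 perm_length) /= e; apply/eqP/val_inj.
rewrite [X in (_ + X + _)%R](_ : _ = F n); last first.
  apply: eq_bigl => t; rewrite /strictly_contained -andbA; congr (_ && _).
  by rewrite andbC /mkperm eq_Tagged.
by rewrite -addrA addNr.
Qed.

(** * Inclusion-exclusion for opposing adjacencies *)

(** At a shared point, the two remaining points would agree in position or in value, hence coincide,
    against the opposite directions. *)
Lemma opposing_adjacencies_disjoint n (p : 'S_n) (i j k l : 'I_n) :
    up_adjacency p i j -> down_adjacency p k l ->
  [/\ i != k, i != l, j != k & j != l].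
Proof.
move=> /andP[/eqP ij /eqP pij] /andP[/eqP kl /eqP pkl].
have ext (a b : 'I_n) : a = b :> nat -> p a = p b :> nat by move/val_inj ->.
have pext (a b : 'I_n) : p a = p b :> nat -> a = b :> nat.
  by move/val_inj/perm_inj ->.
split; apply/eqP => e; subst.
- have := ext j l; lia.
- have := pext k j; lia.
- have := pext i l; lia.
- have := ext i k; lia.
Qed.

Theorem theorem1 (p : permutation) (hp : has_opposing_adjacencies p) :
  mobius singleton_perm p = 0%R.
Proof.
have [N] := ubnP (perm_length p).
elim: N => // N IH in p hp *; rewrite ltnS => pN.
case: p hp pN => n p [/= [i [j up]] [k [l down]]] nN.
have [ik il jk jl] := opposing_adjacencies_disjoint up down.
have ij : i != j.
  by case/andP: up => /eqP ij _; apply/eqP => e; move: ij; rewrite e; lia.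
have kl : k != l.
  by case/andP: down => /eqP kl _; apply/eqP => e; move: kl; rewrite e; lia.
(* The points [i] and [k] survive every deletion below, so all three patterns have length at least
   2, as [mobius_lower_sum] requires. *)
have card_gt1 (A : {set 'I_n}) : i \in A -> k \in A -> 1 < #|A|.
  by move=> iA kA; apply/card_gt1P; exists i, k.
have card_le (A : {set 'I_n}) : #|A| <= n by rewrite -[leqRHS]card_ord max_card.
have [a aP] := exists_pattern p [set~ j].
have [b bP] := exists_pattern p [set~ l].
have [c cP] := exists_pattern p (~: [set j; l]).
have n_gt1 : 1 < n by apply: leq_trans (card_gt1 setT _ _) (card_le _); rewrite ?inE.
rewrite mobiusE; case: eqP => [/(congr1 perm_length) e|_].
  by move: n_gt1; rewrite -[n]/(perm_length (mkperm p)) -e.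
rewrite contained_singleton {1}/perm_length /= ltnW //.
pose low m (q : 'S_m) r :=
  (\sum_(t : 'S_r | contained singleton_perm (mkperm t) &&
     contained (mkperm t) (mkperm q)) mobius singleton_perm (mkperm t))%R.
(* It suffices to match the sums length by length, and then term by term in [t]. *)
suff key r : (\sum_(t : 'S_r | contained singleton_perm (mkperm t) &&
    strictly_contained (mkperm t) (mkperm p)) mobius singleton_perm (mkperm t) =
    low _ a r + low _ b r - low _ c r)%R.
  rewrite (eq_bigr (fun r : 'I_n.+1 => low _ a r + low _ b r - low _ c r)%R); last first.
    by move=> r _; apply: key.
  rewrite sumrB big_split /= !mobius_lower_sum ?addr0 ?subrr ?oppr0 //;
    by rewrite /perm_length /= ?card_le ?card_gt1 // !inE ?negb_or;
       rewrite ?ij ?kl ?ik ?il ?(eq_sym k j) ?jk.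
rewrite /low [LHS]big_mkcond [X in (X + _ - _)%R]big_mkcond.
rewrite [X in (_ + X - _)%R]big_mkcond [X in (_ + _ - X)%R]big_mkcond.
rewrite -big_split -sumrB /=; apply: eq_bigr => t _.
case: (contained singleton_perm _) => /=; last by rewrite subr0 addr0.
have strict (A : {set 'I_n}) (q : 'S_#|A|) (x : 'I_n) : x \notin A ->
    (contained (mkperm t) (mkperm q) <->
     exists2 f, occurrence t p f & {subset codom f <= A}) ->
    contained (mkperm t) (mkperm q) -> strictly_contained (mkperm t) (mkperm p).
  move=> xA qP tq; apply/andP; split; last first.
    by have /qP[f ft _] := tq; apply/existsP; exists f.
  apply: contraTneq (contained_length tq) => /(congr1 perm_length) ->.
  rewrite /perm_length /= -ltnNge -[X in _ < X]card_ord -cardsT proper_card //.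
  by rewrite properT; apply: contraNneq xA => ->; rewrite inE.
have low_a : contained (mkperm t) (mkperm a) ->
    strictly_contained (mkperm t) (mkperm p).
  by apply: (strict _ _ j) (aP _ t); rewrite !inE eqxx.
have low_b : contained (mkperm t) (mkperm b) ->
    strictly_contained (mkperm t) (mkperm p).
  by apply: (strict _ _ l) (bP _ t); rewrite !inE eqxx.
have low_c : contained (mkperm t) (mkperm c) ->
    contained (mkperm t) (mkperm a) /\ contained (mkperm t) (mkperm b).
  move=> /cP[f ft fA].
  split; [apply/aP|apply/bP]; exists f => // x /fA; rewrite !inE;
    by case/norP.
case: (boolP (strictly_contained _ _)) => [tp|ntp]; last first.
  rewrite !ifF ?addr0 ?subr0 //; apply: contraNF ntp; try by [].
  by case/low_c.
(* If [t] has opposing adjacencies, its term is 0 in every sum by induction. *)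
have [/andP[tup tdown]|nopp] :=
    boolP ([exists x, exists y, up_adjacency t x y] &&
           [exists x, exists y, down_adjacency t x y]).
  rewrite IH ?if_same ?addr0 ?subr0 //.
    split; first by case/existsP: tup => x /existsP[y]; exists x, y.
    by case/existsP: tdown => x /existsP[y]; exists x, y.
  exact: leq_trans (strictly_contained_length tp) nN.
(* Moving [f] off [j] adds at most the point [i], which differs from [l]; so if [f] avoids [l], the
   moved occurrence avoids both [j] and [l]. *)
have a_or_c f : occurrence t p f ->
    ~~ [exists x, exists y, up_adjacency t x y] ->
    contained (mkperm t) (mkperm a) /\
    ({subset codom f <= [set~ l]} -> contained (mkperm t) (mkperm c)).
  move=> ft nup.
  have [x y|f' [ft' f'j]] := up_adjacency_avoid up ft.
    by apply: contraNN nup => xy; apply/existsP; exists x; apply/existsP; exists y.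
  split=> [|fl]; [apply/aP|apply/cP]; exists f' => // x /f'j; rewrite !inE.
    by case/andP.
  by rewrite negb_or => /andP[-> /= /predU1P[->//|/fl]]; rewrite !inE.
have b_or_c f : occurrence t p f ->
    ~~ [exists x, exists y, down_adjacency t x y] ->
    contained (mkperm t) (mkperm b) /\
    ({subset codom f <= [set~ j]} -> contained (mkperm t) (mkperm c)).
  move=> ft ndown.
  have [x y|f' [ft' f'l]] := down_adjacency_avoid down ft.
    by apply: contraNN ndown => xy; apply/existsP; exists x; apply/existsP; exists y.
  split=> [|fj]; [apply/bP|apply/cP]; exists f' => // x /f'l; rewrite !inE.
    by case/andP.
  case/andP=> xl xk; rewrite negb_or xl andbT.
  by case/predU1P: xk => [->|/fj]; [rewrite eq_sym|rewrite !inE].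
have /andP[_ /existsP[/= f ft]] := tp.
(* Below [c], the term is counted 1 + 1 - 1 times. Otherwise [t] lies below exactly one of [a] and
   [b]: below both, an occurrence avoiding one deleted point could be moved off the other, putting
   [t] below [c]. *)
case: (boolP (contained _ (mkperm c))) => [/low_c[-> ->]|ntc]; first by rewrite addrK.
rewrite subr0; move: nopp; rewrite negb_and => /orP[nup|ndown].
  rewrite (a_or_c f ft nup).1 ifF ?addr0 //; apply: contraNF ntc => /bP[g gt gl].
  exact: (a_or_c g gt nup).2.
rewrite (b_or_c f ft ndown).1 ifF ?add0r //; apply: contraNF ntc => /aP[g gt gj].
exact: (b_or_c g gt ndown).2.
Qed.
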